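(* Let $R$ be an integral domain, $n\geq 2$, and let $A=C_{m_1}(a_1,b_1)$ and $B=C_{m_2}(a_2,b_2)$ be two $n\times n$ Christoffel matrices over $R$, where $m_1,m_2\in(\mathbb{Z}/n\mathbb{Z})^\times$ and $a_1,a_2,b_1,b_2\in R$ (with $a_1\neq b_1$ and $a_2\neq b_2$). Put $r=\left\lceil \frac{m_1m_2}{n}\right\rceil$ and $s=\left\lfloor \frac{m_1m_2}{n}\right\rfloor$. Then \[AB=BA=C_{m_3}(a_3,b_3),\] where $m_3=m_1m_2\in(\mathbb{Z}/n\mathbb{Z})^\times$ (meaning that $m_1m_2=ns+m_3$ as integers), \[a_3=r\,a_1a_2+(m_1-r)\,a_1b_2+(m_2-r)\,b_1a_2+(n-(m_1+m_2)+r)\,b_1b_2\] and \[b_3=s\,a_1a_2+(m_1-s)\,a_1b_2+(m_2-s)\,b_1a_2+(n-(m_1+m_2)+s)\,b_1b_2.\] Moreover, setting $\delta_i=a_i-b_i$ and $\sigma_i=m_ia_i+(n-m_i)b_i$ for $i=1,2,3$, we have $\delta_3=\delta_1\delta_2\neq 0$ and $\sigma_3=\sigma_1\sigma_2$.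
   Context: For $n\geq 2$, $(\mathbb{Z}/n\mathbb{Z})^\times$ denotes the multiplicative group of integers modulo $n$, identified with the set of integers in $\{0,1,\dots,n-1\}$ coprime to $n$. A binary word on two distinct symbols $a,b$ (ordered formally by $a<b$) is a Christoffel word if it is Lyndon (strictly smaller lexicographically than all its other cyclic conjugates) and cyclically balanced (any two cyclic factors of the same length have numbers of occurrences of $a$ differing by at most $1$). For $m\in(\mathbb{Z}/n\mathbb{Z})^\times$, $c_m(a,b)$ denotes the Christoffel word of length $n$ on the distinct symbols $a,b$, beginning in $a$, with exactly $m$ occurrences of $a$ and $n-m$ occurrences of $b$. The Christoffel matrix $C_m(a,b)$ of size $n$ and type $m$ is the $n\times n$ matrix whose rows are the $n$ cyclic conjugates of $c_m(a,b)$ arranged in increasing lexicographic order (relative to $a<b$), so that its first row is $c_m(a,b)$. Equivalently: the first column of $C_m(a,b)$ consists of $m$ entries $a$ followed by $n-m$ entries $b$, and each subsequent column is the cyclic downward shift by $m$ positions of the preceding column. A Christoffel matrix over $R$ is a matrix $C_m(a,b)$ with $a,b\in R$, $a\neq b$ (the order $a<b$ is purely formal). In ring expressions, an integer coefficient acts in the usual way ($k\,x$ is $k$ times $x$ in the additive group of $R$). *)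

(* Defs.v *)
From HB Require Import structures.
From mathcomp Require Import all_boot all_order all_algebra all_fingroup.

Set Implicit Arguments.
Unset Strict Implicit.
Unset Printing Implicit Defensive.

Import Order.TTheory GRing.Theory Num.Theory.

(* A word on the two formal symbols a < b is a sequence of booleans, [false]
   standing for a and [true] for b. Words are compared through [seqlexi bool],
   the lexicographic order induced by false < true. *)

(* Conjugates are indexed by positions: the strict inequality is required for
   every 0 < i < size w, so that Lyndon words are primitive. *)
Definition lyndon (w : seq bool) : bool :=
  [forall i : 'I_(size w),
     (0 < i)%N ==> ((w : seqlexi bool) < (rot i w : seqlexi bool))%O].

(* The cyclic factors of length k <= size w are the prefixes of length k of the
   conjugates. As i and j range over all pairs of positions, the one-sided
   inequality bounds the absolute difference. *)
Definition cyclically_balanced (w : seq bool) : bool :=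
  [forall k : 'I_(size w).+1, forall i : 'I_(size w), forall j : 'I_(size w),
     (count_mem false (take k (rot i w))
        <= (count_mem false (take k (rot j w))).+1)%N].

Definition christoffel (w : seq bool) : bool :=
  lyndon w && cyclically_balanced w.

(* c_m(a, b): [pick] selects the Christoffel word of length n beginning in a
   with m occurrences of a. This word exists and is unique for 0 < m < n with
   m coprime to n; the default value is irrelevant there. *)
Definition christoffel_word (n m : nat) : n.-tuple bool :=
  odflt (nseq_tuple n true)
    [pick w : n.-tuple bool |
       [&& christoffel w, ohead w == Some false & count_mem false w == m]].

Definition conjugates (w : seq bool) : seq (seq bool) :=
  [seq rot i w | i <- iota 0 (size w)].

Definition sorted_conjugates (w : seq bool) : seq (seq bool) :=
  sort (fun u v => ((u : seqlexi bool) <= (v : seqlexi bool))%O) (conjugates w).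

(* C_m(a, b), of size n *)
Definition christoffel_mx (T : Type) (n m : nat) (a b : T) : 'M[T]_n :=
  \matrix_(i, j)
    (if nth false (nth [::] (sorted_conjugates (christoffel_word n m)) i) j
     then b else a).

(* The representative in {0, ..., n - 1} of a unit of Z/nZ, for n >= 2
   ('Z_n is 'I_n only in that range). *)
Definition unit_repr (n : nat) (u : {unit 'Z_n}) : nat := nat_of_ord (val u).

(* Main.v *)
Require Import Defs.
From HB Require Import structures.
From mathcomp Require Import all_boot all_order all_algebra all_fingroup.
From mathcomp Require Import zify ring.

Import Order.TTheory GRing.Theory Num.Theory.


(** Write [false] for a, [true] for b, and q = n - m. Everything rests on an
    arithmetic description of C_m(a, b): the entry (i, j) is b exactly when
    (i + j q) mod n >= m. Along a row the argument x = i + j q moves by q, and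
    the letter at x is b exactly when adding q to x crosses a multiple of n;
    hence the first t letters of row i contain floor((i + t q) / n) letters b
    when i < n ([sum_letter]).

    This description is reached from the definition by Lyndon words and balance
    in two steps. A Christoffel word is determined by its length and its number
    of b's ([christoffel_uniq]): by minimality and balance, its prefix of length
    t has the fewest b's among the cyclic factors of length t, and the other
    factors have at most one more, so an average over all factors gives the
    number of b's in the prefix. On the other hand, the word j |-> letter at j q
    is balanced by the floor formula, and its conjugates are the rows i, which
    increase strictly with i ([row_word_ltS]); so it is a Christoffel word, and
    sorting its conjugates lists the rows in order ([sorted_conjugatesE]).

    For the product, write each entry as b + [entry is a] (a - b). Expanding
    \sum_l A(i, l) B(l, j), every row of A has m1 entries a, every column of B
    has m2 entries a, and only the number K of l with both entries a is left to
    compute. The a's of column j of B occupy m2 cyclically consecutive places,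
    so K counts a's in a factor of length m2 of a cyclic row of A. The floor
    formula shows that K = s + 1 where C_(m3) has a, and K = s where it has
    b ([sum_false_row_col]). The resulting entries are symmetric in the two
    factors, hence AB = BA; the identities on the delta's and sigma's are
    polynomial identities modulo m1 m2 = n s + m3. *)

(** * Binary words and their cyclic factors *)

Lemma sum_periodic (V : nmodType) (n : nat) (F : nat -> V) (c : nat) :
  (forall l, F (l + n) = F l) ->
  (\sum_(l < n) F (c + l)%N = \sum_(l < n) F l)%R.
Proof.
move=> FD; elim: c => [|c IHc] //; rewrite -IHc.
case: n FD {IHc} => [|n] FD; first by rewrite !big_ord0.
rewrite big_ord_recr big_ord_recl /= addrC addn0 addSnnS FD.
by congr (_ + _)%R; apply: eq_bigr => l _; rewrite /bump addSnnS.
Qed.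

Lemma ltxi_bitseqP (u v : bitseq) : size u = size v ->
  reflect (exists p, [/\ p < size u, forall l, l < p -> nth false u l = nth false v l,
                        nth false u p = false & nth false v p = true])
          ((u : seqlexi bool) < (v : seqlexi bool))%O.
Proof.
elim: u v => [|x u IHu] [|y v] //= => [_|[suv]].
  by rewrite ltxx; constructor=> -[p []].
rewrite ltxi_cons; apply: (iffP andP) => [[]|].
- case: x y => [] [] //= _ => [/(IHu _ suv)|_|/(IHu _ suv)].
  + case=> p [pu eqp up vp]; exists p.+1; split=> // -[|l] //; exact: eqp.
  + by exists 0.
  + case=> p [pu eqp up vp]; exists p.+1; split=> // -[|l] //; exact: eqp.
- case=> -[|p] [/= pu eqp up vp]; first by rewrite up vp.
  have -> : x = y by apply: (eqp 0).
  rewrite lexx; split=> //=; apply/IHu => //.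
  by exists p; split=> // l lp; apply: (eqp l.+1).
Qed.

Definition ones (w : bitseq) (i t : nat) : nat :=
  \sum_(l < t) nth false w ((i + l) %% size w).

Lemma onesD (w : bitseq) (i t u : nat) :
  ones w i (t + u) = ones w i t + ones w (i + t) u.
Proof.
rewrite /ones big_split_ord /=; congr addn.
by apply: eq_bigr => l _; rewrite addnA.
Qed.

Lemma onesS (w : bitseq) (i t : nat) :
  ones w i t.+1 = ones w i t + nth false w ((i + t) %% size w).
Proof. by rewrite /ones big_ord_recr. Qed.

Lemma nth_rot_mod (w : bitseq) (i l : nat) : i <= size w -> l < size w ->
  nth false (rot i w) l = nth false w ((i + l) %% size w).
Proof.
move=> iw lw; rewrite /rot nth_cat size_drop nth_drop; case: ltnP => h.
  by rewrite modn_small //; lia.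
rewrite nth_take; last by lia.
have -> : i + l = (l - (size w - i)) + size w by lia.
by rewrite modnDr modn_small //; lia.
Qed.

Lemma count_true_sum (w : bitseq) :
  count_mem true w = \sum_(l < size w) nth false w l.
Proof.
elim: w => [|x w IHw] /=; first by rewrite big_ord0.
by rewrite big_ord_recl /= IHw; case: x.
Qed.

Lemma count_false_true (w : bitseq) :
  count_mem false w + count_mem true w = size w.
Proof.
rewrite -(count_predC (pred1 false) w); congr addn.
by apply: eq_count => -[].
Qed.

Lemma count_take_rot (w : bitseq) (i t : nat) : i <= size w -> t <= size w ->
  count_mem false (take t (rot i w)) + ones w i t = t.
Proof.
move=> iw tw.
have st : size (take t (rot i w)) = t by rewrite size_takel ?size_rot.
rewrite -{3}st -count_false_true count_true_sum st; congr addn.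
by apply: eq_bigr => l _; rewrite nth_take // nth_rot_mod //; apply: leq_trans tw.
Qed.

(** Replacing the count of a's by that of b's reverses the inequality, which
    the symmetry in i and j absorbs. *)
Lemma balancedP (w : bitseq) :
  reflect (forall t i j, t <= size w -> i < size w -> j < size w ->
             ones w i t <= (ones w j t).+1)
          (cyclically_balanced w).
Proof.
have swap t i j : t <= size w -> i < size w -> j < size w ->
    (count_mem false (take t (rot i w)) <= (count_mem false (take t (rot j w))).+1)
    = (ones w j t <= (ones w i t).+1).
  move=> tw iw jw.
  have := count_take_rot _ _ _ (ltnW iw) tw; have := count_take_rot _ _ _ (ltnW jw) tw.
  by move: (count_mem _ _) (count_mem _ _) => ? ?; lia.
apply: (iffP idP) => [bw t i j tw iw jw|bw].
  have /forallP/(_ (Ordinal (tw : t < (size w).+1))) := bw.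
  by move=> /forallP/(_ (Ordinal jw))/forallP/(_ (Ordinal iw)); rewrite swap.
apply/forallP=> t; apply/forallP=> i; apply/forallP=> j.
have tw : t <= size w by rewrite -ltnS.
by rewrite swap // bw.
Qed.

(** * Uniqueness of the Christoffel word *)

(** If a cyclic factor at i had fewer b's than the prefix of the same length t,
    let p be the first place where w and its conjugate at i differ. There w has
    an a and the conjugate has a b, since w is the smaller one. So after p the
    factor must make up for two b's with respect to w, against balance. *)
Lemma ones_min (w : bitseq) (i t : nat) : christoffel w ->
  i < size w -> t <= size w -> ones w 0 t <= ones w i t.
Proof.
case/andP=> lw /balancedP bw iw tw; rewrite leqNgt; apply/negP=> lt_i.
have i0 : 0 < i by case: (posnP i) lt_i => [->|//]; rewrite ltnn.
have w0 : 0 < size w by apply: leq_ltn_trans iw.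
have /forallP/(_ (Ordinal iw))/implyP/(_ i0) /= := lw.
case/ltxi_bitseqP; first by rewrite size_rot.
move=> p [pw eqp wp rp].
have eq_ones u : u <= p -> ones w 0 u = ones w i u.
  move=> up; apply: eq_bigr => l _.
  have lp : l < p by apply: leq_trans up.
  have ls : l < size w by apply: ltn_trans pw.
  by rewrite add0n modn_small // eqp // nth_rot_mod // ltnW.
have pt : p < t by rewrite ltnNge; apply/negP=> /eq_ones; lia.
have := onesD w 0 p.+1 (t - p.+1); have := onesD w i p.+1 (t - p.+1).
rewrite subnKC // !onesS (eq_ones p) // add0n (modn_small pw) wp.
rewrite -(nth_rot_mod _ _ _ (ltnW iw) pw) rp.
have shift v : ones w v (t - p.+1) = ones w (v %% size w) (t - p.+1).
  by apply: eq_bigr => l _; rewrite modnDml.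
have := bw (t - p.+1) (p.+1 %% size w) ((i + p.+1) %% size w).
rewrite !ltn_mod w0 -!shift (add0n p.+1) => /(_ _ isT isT); lia.
Qed.

(** Every position of the cyclic word lies in exactly t of the cyclic factors of
    length t. *)
Lemma sum_ones (w : bitseq) (t : nat) :
  \sum_(i < size w) ones w i t = t * count_mem true w.
Proof.
rewrite exchange_big /= count_true_sum -[t in RHS]card_ord -sum_nat_const.
apply: eq_bigr => l _.
pose F x := nth false w (x %% size w) : nat.
transitivity (\sum_(i < size w) F (l + i)); first by apply: eq_bigr => i _; rewrite addnC.
rewrite (@sum_periodic nat) => [|x]; last by rewrite /F modnDr.
by apply: eq_bigr => i _; rewrite /F modn_small.
Qed.

(** All cyclic factors of length t have P or P + 1 letters b, where P is the
    value on the prefix; their average t q / n thus lies in [P, P + 1), the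
    upper end being excluded because the prefix itself has only P. *)
Lemma christoffel_prefix (w : bitseq) (t : nat) : christoffel w ->
  t <= size w -> ones w 0 t = t * count_mem true w %/ size w.
Proof.
move=> cw tw; have [w0|w0] := posnP (size w).
  by move: tw; rewrite w0 leqn0 => /eqP ->; rewrite divn0 /ones big_ord0.
have lb : size w * ones w 0 t <= t * count_mem true w.
  rewrite -sum_ones -[size w in X in X <= _]card_ord -sum_nat_const.
  by apply: leq_sum => i _; apply: ones_min.
have ub : t * count_mem true w < size w * (ones w 0 t).+1.
  rewrite -sum_ones -[size w in X in _ < X]card_ord -sum_nat_const.
  rewrite [ltnLHS](bigD1 (Ordinal w0)) // [ltnRHS](bigD1 (Ordinal w0)) //=.
  rewrite addSn ltnS leq_add2l; apply: leq_sum => i _.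
  by case/andP: cw => _ /balancedP; apply.
apply/eqP; rewrite eqn_leq leq_divRL // mulnC lb /=.
by rewrite -ltnS ltn_divLR // [ltnRHS]mulnC.
Qed.

Lemma christoffel_uniq (u v : bitseq) : christoffel u -> christoffel v ->
  size u = size v -> count_mem true u = count_mem true v -> u = v.
Proof.
move=> cu cv suv quv; apply: (@eq_from_nth _ false) => // l lu.
have lv : l < size v by rewrite -suv.
apply: (can_inj oddb).
have last (w : bitseq) : l < size w -> ones w 0 l.+1 = ones w 0 l + nth false w l.
  by move=> lw; rewrite onesS add0n modn_small.
have := last u lu; rewrite !christoffel_prefix // 1?ltnW // suv quv.
by rewrite -!christoffel_prefix // 1?ltnW // last // => /addnI.
Qed.

(** * The rows of a Christoffel matrix *)

Definition letter (n m x : nat) : bool := m <= x %% n.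

Lemma letterDn (n m x c : nat) : letter n m (x + c * n) = letter n m x.
Proof. by rewrite /letter addnC modnMDl. Qed.

(** The sum telescopes: the letter at y is b exactly when y + (n - m) and y have
    different quotients by n, and then these differ by 1. *)
Lemma sum_letter (n m x t : nat) : 0 < n -> m <= n ->
  \sum_(l < t) letter n m (x + l * (n - m)) + x %/ n = (x + t * (n - m)) %/ n.
Proof.
move=> n0 mn; elim: t => [|t IHt]; first by rewrite big_ord0 addn0.
rewrite big_ord_recr /= addnAC IHt mulSnr addnA /letter.
move: (x + _) => y; rewrite {3}(divn_eq y n) -addnA divnMDl //; congr addn.
have := ltn_pmod y n0; case: (leqP m) => h yn.
  have -> : y %% n + (n - m) = 1 * n + (y %% n - m) by lia.
  by rewrite divnMDl // divn_small //; lia.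
by rewrite divn_small //; lia.
Qed.

(** Shifting a column down by m means replacing i by i - m; the step n - m,
    congruent to - m, keeps the arguments natural numbers. *)
Definition row_word (n m i : nat) : n.-tuple bool :=
  [tuple letter n m (i + j * (n - m)) | j < n].

Lemma nth_row_word (n m i j : nat) : j < n ->
  nth false (row_word n m i) j = letter n m (i + j * (n - m)).
Proof.
move=> jn; rewrite (nth_map (Ordinal jn)) ?size_enum_ord //.
by rewrite nth_enum_ord.
Qed.

Lemma rot_row_word (n m i : nat) : i <= n ->
  rot i (row_word n m 0) = row_word n m ((i * (n - m)) %% n).
Proof.
move=> le_in; apply: (@eq_from_nth _ false); rewrite ?size_rot ?size_tuple // => j jn.
rewrite nth_rot_mod ?size_tuple // !nth_row_word ?ltn_mod //; last by case: n jn {le_in}.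
by rewrite /letter add0n modnDml modnMml mulnDl.
Qed.

Lemma ones_row_word (n m i t : nat) : 0 < m < n ->
  ones (row_word n m 0) i t = (((i * (n - m)) %% n) + t * (n - m)) %/ n.
Proof.
case/andP=> m0 mn; have n0 : 0 < n by apply: ltn_trans mn.
rewrite -(sum_letter _ _ _ _ n0 (ltnW mn)) (@divn_small (_ %% _)) ?ltn_mod // addn0.
apply: eq_bigr => l _; rewrite size_tuple nth_row_word ?ltn_mod //.
by rewrite /letter add0n modnDml modnMml mulnDl.
Qed.

Lemma count_row_word (n m : nat) : 0 < m < n ->
  count_mem true (row_word n m 0) = n - m.
Proof.
move=> mn; transitivity (ones (row_word n m 0) 0 n).
  rewrite count_true_sum /ones size_tuple; apply: eq_bigr => l _.
  by rewrite add0n modn_small.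
by rewrite ones_row_word // mul0n mod0n add0n mulKn //; lia.
Qed.

Lemma mulmod_inj (n q l j : nat) : coprime n q -> l < n -> j < n ->
  l * q = j * q %[mod n] -> l = j.
Proof.
move=> co; wlog lj : l j / l <= j => [hw ln jn e|ln jn /esym/eqP].
  by case: (leqP l j) => [|/ltnW] h; [|apply: esym]; apply: hw.
rewrite eqn_mod_dvd ?leq_mul2r ?lj ?orbT // -mulnBl Gauss_dvdl //.
have [|lt_lj] := leqP j l; first by lia.
by move/dvdn_leq; lia.
Qed.

Lemma coprime_complement (n m : nat) : m <= n -> coprime m n -> coprime n (n - m).
Proof.
move=> mn; rewrite -{1 2}(subnKC mn) /coprime; move: (n - m) => k.
by rewrite gcdnDl (gcdnC (m + k)) addnC gcdnDl gcdnC.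
Qed.

(** Increasing the argument of a letter by 1 changes it only at the residues
    m - 1 (from a to b) and n - 1 (from b to a). As q is invertible modulo n,
    row i meets m - 1 at one position p; it meets n - 1 = (m - 1) + q at the
    position that cyclically follows p, and this position is not 0 because
    i <> n - 1. So the first change is the one from a to b. *)
Lemma row_word_ltS (n m i : nat) : coprime m n -> 0 < m < n -> i.+1 < n ->
  ((tval (row_word n m i) : seqlexi bool) < (tval (row_word n m i.+1) : seqlexi bool))%O.
Proof.
move=> co mn iN; set q := n - m.
have coq : coprime n q by apply: coprime_complement => //; lia.
have q0 : 0 < q by rewrite /q; lia.
have n0 : 0 < n by lia.
(* u is an inverse of q modulo n, so p = u (m - 1 - i) mod n solves the
   congruence; n is added to keep the subtraction in nat. *)
have [p pn rp] : exists2 p, p < n & (i + p * q) %% n = m.-1.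
  have [u v uv _] := egcdnP n q0; pose c := m.-1 + (n - i).
  exists ((u * c) %% n); first by rewrite ltn_mod.
  rewrite -modnDmr modnMml modnDmr mulnAC uv [gcdn _ _]gcdnC (eqP coq).
  have -> : i + (v * n + 1) * c = (v * c + 1) * n + m.-1 by rewrite /c; lia.
  by rewrite modnMDl modn_small //; lia.
have uniq_p l : l < n -> (i + l * q) %% n = m.-1 -> l = p.
  move=> ln; rewrite -rp => /eqP; rewrite eqn_modDl => /eqP.
  exact: mulmod_inj.
apply/ltxi_bitseqP; first by rewrite !size_tuple.
exists p; split=> [|l lp||]; rewrite ?size_tuple ?nth_row_word -/q ?(ltn_trans lp) //.
- rewrite /letter addSn.
  have ln := ltn_trans lp pn.
  have lm : (i + l * q) %% n <> m.-1 by move/(uniq_p _ ln); lia.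
  (* Meeting n - 1 at l means meeting m - 1 at l - 1, which is less than p. *)
  have ll : (i + l * q) %% n <> n.-1.
    case: l lp ln {lm} => [|l] lp ln; first by rewrite addn0 modn_small; lia.
    move=> e; suff /(uniq_p l (ltnW ln)) : (i + l * q) %% n = m.-1 by lia.
    have : (i + l * q) + q = n.-1 %[mod n].
      by rewrite -addnA -mulSnr e modn_small //; lia.
    have -> : n.-1 = m.-1 + q by rewrite /q; lia.
    by move/eqP; rewrite eqn_modDr => /eqP ->; rewrite modn_small //; lia.
  rewrite -[(_ + _).+1]addn1 -(modnDml (i + l * q)) addn1.
  have := ltn_pmod (i + l * q) n0; move: (_ %% n) lm ll => x lm ll xn.
  by rewrite modn_small; lia.
- by rewrite /letter rp; lia.
- by rewrite /letter addSn -[(_ + _).+1]addn1 -(modnDml (i + p * q)) rp modn_small; lia.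
Qed.

Lemma row_word_lt (n m i j : nat) : coprime m n -> 0 < m < n -> i < j < n ->
  ((tval (row_word n m i) : seqlexi bool) < (tval (row_word n m j) : seqlexi bool))%O.
Proof.
move=> co mn; elim: j => [|j IHj] //; rewrite ltnS leq_eqVlt => /andP[].
case/predU1P => [-> |ij] jn; first exact: row_word_ltS.
by apply: lt_trans (row_word_ltS _ _ _ co mn jn); apply: IHj; rewrite ij ltnW.
Qed.

Lemma christoffel_row_word (n m : nat) : coprime m n -> 0 < m < n ->
  christoffel (row_word n m 0).
Proof.
move=> co mn; have n0 : 0 < n by lia.
apply/andP; split.
  apply/forallP=> i; apply/implyP=> i0; have := ltn_ord i; rewrite [X in _ < X]size_tuple => iN.
  rewrite rot_row_word ?(ltnW iN) //; apply: row_word_lt => //.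
  rewrite ltn_mod n0 andbT lt0n; apply/eqP=> e.
  have coq : coprime n (n - m) by apply: coprime_complement => //; lia.
  have := mulmod_inj n (n - m) i 0 coq iN n0; rewrite e mul0n mod0n => /(_ erefl).
  by lia.
apply/balancedP=> t i j _ _ _; rewrite !ones_row_word //.
have shift z : (z %/ n).+1 = (z + n) %/ n by rewrite divnDr // divnn n0 addn1.
rewrite shift leq_div2r //.
by have := ltn_pmod (i * (n - m)) n0; lia.
Qed.

Lemma christoffel_wordE (n m : nat) : coprime m n -> 0 < m < n ->
  christoffel_word n m = row_word n m 0.
Proof.
move=> co mn; rewrite /christoffel_word; case: pickP => [w|/(_ (row_word n m 0))/negP[]].
  case/and3P=> cw _ /eqP cm; apply/val_inj/christoffel_uniq => //.
  - exact: christoffel_row_word.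
  - by rewrite !size_tuple.
  apply/eqP; rewrite count_row_word // -(eqn_add2l m) -{1}cm count_false_true size_tuple.
  by apply/eqP; lia.
apply/and3P; split; first exact: christoffel_row_word.
  have n0 : 0 < n by lia.
  have := nth_row_word n m 0 0 n0; rewrite /letter add0n mod0n leqNgt.
  have := size_tuple (row_word n m 0); case: (tval _) => [|x s] /=; first by lia.
  by move=> _ ->; have -> : 0 < m by lia.
rewrite -(eqn_add2r (count_mem true (row_word n m 0))) count_false_true.
by rewrite count_row_word // size_tuple; apply/eqP; lia.
Qed.

Lemma sorted_conjugatesE (n m : nat) : coprime m n -> 0 < m < n ->
  sorted_conjugates (christoffel_word n m)
  = [seq tval (row_word n m i) | i <- iota 0 n].
Proof.
move=> co mn; have n0 : 0 < n by lia.
apply: (@le_sorted_eq _ (seqlexi bool)).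
- exact: sort_le_sorted.
- apply/(sortedP [::]) => i; rewrite size_map size_iota => iN.
  rewrite !(nth_map 0) ?size_iota // 1?ltnW // !nth_iota // 1?ltnW //.
  by apply/ltW/row_word_ltS.
rewrite perm_sort christoffel_wordE // /Defs.conjugates size_tuple.
have -> : [seq rot i (row_word n m 0) | i <- iota 0 n] =
    map (fun i => tval (row_word n m i)) [seq (i * (n - m)) %% n | i <- iota 0 n].
  rewrite -map_comp; apply/eq_in_map=> i; rewrite mem_iota => iN.
  by rewrite rot_row_word //= ltnW.
apply: (@perm_map _ (seqlexi bool)); rewrite perm_sym.
have uq : uniq [seq (i * (n - m)) %% n | i <- iota 0 n].
  rewrite map_inj_in_uniq ?iota_uniq // => i j; rewrite !mem_iota => iN jN.
  by apply: mulmod_inj => //; apply: coprime_complement => //; lia.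
have sub : {subset [seq (i * (n - m)) %% n | i <- iota 0 n] <= iota 0 n}.
  by move=> _ /mapP[i _ ->]; rewrite mem_iota ltn_mod.
have [|_ eqi] := uniq_min_size uq sub; first by rewrite size_map.
by rewrite perm_sym; apply: uniq_perm => //; apply: iota_uniq.
Qed.

(** The description of the entries on which the product formula relies; the
    lexicographic order does not appear any more. *)
Lemma christoffel_mxE (T : Type) (n m : nat) (a b : T) (i j : 'I_n) :
  coprime m n -> 0 < m < n ->
  christoffel_mx n m a b i j = if letter n m (i + j * (n - m)) then b else a.
Proof.
move=> co mn; rewrite mxE sorted_conjugatesE // (nth_map 0) ?size_iota //.
by rewrite nth_iota // add0n nth_row_word.
Qed.

(** * Counting the letters a *)

Lemma letter_sumC (n m x t : nat) : 0 < n -> m <= n ->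
  \sum_(l < t) ~~ letter n m (x + l * (n - m)) + (x + t * (n - m)) %/ n
  = t + x %/ n.
Proof.
move=> n0 mn; rewrite -(sum_letter n m x t) // addnA; congr addn.
rewrite -big_split /= -[t in RHS]card_ord -sum1_card.
by apply: eq_bigr => l _; case: letter.
Qed.

Lemma sum_false_row (n m x : nat) : 0 < m < n ->
  \sum_(l < n) ~~ letter n m (x + l * (n - m)) = m.
Proof.
move=> mn; have n0 : 0 < n by lia.
have := letter_sumC n m x n n0; rewrite mulnC divnDMl //; lia.
Qed.

Lemma sum_false_col (n m j : nat) : 0 < m < n ->
  \sum_(l < n) ~~ letter n m (l + j * (n - m)) = m.
Proof.
move=> mn.
transitivity (\sum_(l < n) ~~ letter n m l).
  rewrite -(@sum_periodic nat n (fun l => ~~ letter n m l : nat) (j * (n - m))).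
    by apply: eq_bigr => l _; rewrite addnC.
  by move=> l; rewrite /letter modnDr.
transitivity (\sum_(l < n | l < m) 1); last first.
  by rewrite -(big_ord_widen n (fun=> 1)) ?sum1_card ?card_ord //; lia.
rewrite [RHS]big_mkcond; apply: eq_bigr => l _.
by rewrite /letter modn_small // -ltnNge; case: (l < m).
Qed.

(** The a's of column j of the second matrix are at l = j m2 + t modulo n with
    t < m2. So the sum counts the a's among m2 consecutive letters of a row of
    the first matrix, starting at the argument x, congruent to i - j m1 m2, and
    [letter_sumC] evaluates it. As m2 q1 = - m3 modulo n, the correction by the
    remainder is the letter of the product matrix at (i, j). *)
Lemma sum_false_row_col (n m1 m2 i j : nat) : 0 < m1 < n -> 0 < m2 < n ->
  \sum_(l < n) (~~ letter n m1 (i + l * (n - m1))) * (~~ letter n m2 (l + j * (n - m2)))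
   + letter n (m1 * m2 %% n) (i + j * (n - m1 * m2 %% n)) = (m1 * m2 %/ n).+1.
Proof.
move=> mn1 mn2; have n0 : 0 < n by lia.
set s := _ %/ n; set m3 := _ %% n; set q1 := n - m1.
have es : m1 * m2 = s * n + m3 by exact: divn_eq.
have m3n : m3 < n by rewrite ltn_mod.
have sm : s < m2 by rewrite /s ltn_divLR // [ltnRHS]mulnC ltn_pmul2r; lia.
pose F l := (~~ letter n m1 (i + l * q1)) * (~~ letter n m2 (l + j * (n - m2))).
have FD l : F (l + n) = F l.
  rewrite /F mulnDl [n * _]mulnC addnA letterDn.
  by rewrite addnAC [letter n m2 (_ + n)]/letter modnDr.
(* Start the sum over l at the first a of column j. *)
rewrite -[X in X + _](@sum_periodic nat n F (j * m2) FD) /F.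
pose x := i + j * m2 * q1.
have -> : \sum_(l < n) (~~ letter n m1 (i + (j * m2 + l) * q1)) *
     (~~ letter n m2 (j * m2 + l + j * (n - m2)))
   = \sum_(l < m2) ~~ letter n m1 (x + l * q1).
  rewrite (big_ord_widen n (fun l => ~~ letter n m1 (x + l * q1) : nat)); last by lia.
  rewrite [RHS]big_mkcond; apply: eq_bigr => l _.
  have -> : j * m2 + l + j * (n - m2) = l + j * n.
    by rewrite addnAC -mulnDr subnKC 1?addnC //; lia.
  rewrite letterDn {2}/letter modn_small // -ltnNge mulnDl addnA.
  by case: (l < m2); rewrite ?muln1 ?muln0.
have e2 : m2 * q1 = (n - m3) + (m2 - s.+1) * n.
  rewrite /q1 mulnBr mulnBl mulSn mulnC [m2 * m1]mulnC es.
  have : s.+1 * n <= n * m2 by rewrite mulnC leq_mul2l sm orbT.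
  by rewrite mulSn; lia.
have -> : letter n m3 (i + j * (n - m3)) = letter n m3 x.
  by rewrite /x -mulnA e2 mulnDr addnA mulnA letterDn.
have := letter_sumC n m1 x m2 n0; rewrite -/q1 e2 addnA divnDMl //.
have := sum_letter n m3 x 1 n0 (ltnW m3n).
rewrite big_ord1 mul0n addn0 mul1n; lia.
Qed.

Local Open Scope ring_scope.

(** * The product *)

(** The entries a3 and b3 for q = r and q = s: q is the number of places where
    the row and the column both have an a, and the other three coefficients
    follow from the numbers m1 and m2 of a's in the row and in the column. *)
Definition mixed_entry {R : comRingType} (a1 b1 a2 b2 : R) (N m1 m2 q : int) : R :=
  (a1 * a2) *~ q + (a1 * b2) *~ (m1 - q) + (b1 * a2) *~ (m2 - q)
  + (b1 * b2) *~ (N - (m1 + m2) + q).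

(** The basis (a1 - b1, b1) x (a2 - b2, b2) makes q appear in one term only, and
    it is the form that comes from expanding the product of the entries. *)
Lemma mixed_entryE (R : comRingType) (a1 b1 a2 b2 : R) (N m1 m2 q : int) :
  mixed_entry a1 b1 a2 b2 N m1 m2 q =
  q%:~R * ((a1 - b1) * (a2 - b2)) + m1%:~R * ((a1 - b1) * b2)
  + m2%:~R * (b1 * (a2 - b2)) + N%:~R * (b1 * b2).
Proof. by rewrite /mixed_entry -!(mulrzr (_ * _)) !(intrD, intrB); ring. Qed.

Lemma mixed_entryC (R : comRingType) (a1 b1 a2 b2 : R) (N m1 m2 q : int) :
  mixed_entry a2 b2 a1 b1 N m2 m1 q = mixed_entry a1 b1 a2 b2 N m1 m2 q.
Proof. by rewrite !mixed_entryE; ring. Qed.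

Lemma mixed_entry_delta (R : comRingType) (a1 b1 a2 b2 : R) (N m1 m2 q : int) :
  mixed_entry a1 b1 a2 b2 N m1 m2 (q + 1) - mixed_entry a1 b1 a2 b2 N m1 m2 q
  = (a1 - b1) * (a2 - b2).
Proof. by rewrite !mixed_entryE intrD; ring. Qed.

Lemma mixed_entry_sigma (R : comRingType) (a1 b1 a2 b2 : R) (N m1 m2 m3 q : int) :
  m1 * m2 = N * q + m3 ->
  mixed_entry a1 b1 a2 b2 N m1 m2 (q + 1) *~ m3
    + mixed_entry a1 b1 a2 b2 N m1 m2 q *~ (N - m3)
  = (a1 *~ m1 + b1 *~ (N - m1)) * (a2 *~ m2 + b2 *~ (N - m2)).
Proof.
move=> e; have -> : m3 = m1 * m2 - N * q by rewrite e addrC addKr.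
rewrite !mixed_entryE -(mulrzr a1) -(mulrzr b1) -(mulrzr a2) -(mulrzr b2).
rewrite -!(mulrzr (_ + _)) !(intrB, intrD, intrM); ring.
Qed.

Lemma mul_christoffel_mx (R : comRingType) (n m1 m2 : nat) (a1 b1 a2 b2 : R) :
  (0 < m1 < n)%N -> (0 < m2 < n)%N -> coprime m1 n -> coprime m2 n ->
  (0 < m1 * m2 %% n)%N ->
  let s := (m1 * m2 %/ n)%N in
  let c (q : nat) := mixed_entry a1 b1 a2 b2 n m1 m2 q in
  christoffel_mx n m1 a1 b1 *m christoffel_mx n m2 a2 b2
  = christoffel_mx n (m1 * m2 %% n) (c s.+1) (c s).
Proof.
move=> mn1 mn2 co1 co2 m30 s c; apply/matrixP=> i j; rewrite mxE.
have n0 : (0 < n)%N by lia.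
rewrite christoffel_mxE ?m30 ?ltn_mod // ?coprime_modl ?coprimeMl ?co1 ?co2 //.
have entry m (a b : R) x : (if letter n m x then b else a) = b + (~~ letter n m x)%:R * (a - b).
  by case: letter; rewrite /= ?mul0r ?mul1r ?addr0 // addrC subrK.
pose k := (\sum_(l < n) (~~ letter n m1 (i + l * (n - m1))) * (~~ letter n m2 (l + j * (n - m2))))%N.
transitivity (c k).
  rewrite /c mixed_entryE -!pmulrn -[X in X%:R * ((a1 - b1) * b2)](sum_false_row n m1 i) //.
  rewrite -[X in X%:R * (b1 * (a2 - b2))](sum_false_col n m2 j) //.
  have -> : n%:R * (b1 * b2) = \sum_(l < n) b1 * b2 by rewrite sumr_const card_ord mulr_natl.
  rewrite /k !natr_sum !mulr_suml -!big_split /=; apply: eq_bigr => l _.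
  by rewrite !christoffel_mxE // !entry natrM; ring.
have := sum_false_row_col n m1 m2 i j mn1 mn2; rewrite -/k -/s.
by case: letter; rewrite ?addn0 ?addn1; [case=> -> | move->].
Qed.

(** * Units modulo n and rational quotients *)

Lemma floor_divn (n k : nat) : (0 < n)%N ->
  Num.floor (k%:~R / n%:~R : rat) = (k %/ n)%N.
Proof.
move=> n0; apply: floor_def; have n0' : (0 : rat) < n%:~R by rewrite ltr0z; lia.
rewrite ler_pdivlMr // ltr_pdivrMr // -!intrM ler_int ltr_int.
by have := divn_eq k n; have := ltn_pmod k n0; lia.
Qed.

Lemma ceil_divn (n k : nat) : (0 < n)%N -> (0 < k %% n)%N ->
  Num.ceil (k%:~R / n%:~R : rat) = (k %/ n).+1.
Proof.
move=> n0 k0; apply: ceil_def; have n0' : (0 : rat) < n%:~R by rewrite ltr0z; lia.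
rewrite ltr_pdivlMr // ler_pdivrMr // -!intrM ler_int ltr_int.
by have := divn_eq k n; have := ltn_pmod k n0; lia.
Qed.

Lemma unit_repr_coprime (n : nat) (u : {unit 'Z_n}) : (1 < n)%N ->
  coprime (unit_repr u) n.
Proof.
move=> n1; have := valP u.
by rewrite -[X in X \is a _]natr_Zp unitZpE // coprime_sym.
Qed.

Lemma unit_repr_bounds (n : nat) (u : {unit 'Z_n}) : (1 < n)%N ->
  (0 < unit_repr u < n)%N.
Proof.
move=> n1; apply/andP; split.
  have := unit_repr_coprime n u n1; case: posnP => // ->.
  by rewrite /coprime gcd0n; lia.
by have := ltn_ord (val u); rewrite [X in (_ < X)%N]Zp_cast.
Qed.

Lemma unit_reprM (n : nat) (u v : {unit 'Z_n}) : (1 < n)%N ->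
  unit_repr (u * v)%g = (unit_repr u * unit_repr v %% n)%N.
Proof. by case: n u v => [|[|n]]. Qed.

Theorem lemma1 (R : idomainType) (n : nat) (hn : (2 <= n)%N)
    (u1 u2 : {unit 'Z_n}) (a1 a2 b1 b2 : R) (hab1 : a1 != b1) (hab2 : a2 != b2) :
  let m1 : int := Posz (unit_repr u1) in
  let m2 : int := Posz (unit_repr u2) in
  let u3 : {unit 'Z_n} := (u1 * u2)%g in
  let m3 : int := Posz (unit_repr u3) in
  let N : int := Posz n in
  let A : 'M[R]_n := christoffel_mx n (unit_repr u1) a1 b1 in
  let B : 'M[R]_n := christoffel_mx n (unit_repr u2) a2 b2 in
  let r : int := Num.ceil ((m1 * m2)%:~R / N%:~R : rat) in
  let s : int := Num.floor ((m1 * m2)%:~R / N%:~R : rat) in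
  let a3 : R := (a1 * a2) *~ r + (a1 * b2) *~ (m1 - r) + (b1 * a2) *~ (m2 - r)
                + (b1 * b2) *~ (N - (m1 + m2) + r) in
  let b3 : R := (a1 * a2) *~ s + (a1 * b2) *~ (m1 - s) + (b1 * a2) *~ (m2 - s)
                + (b1 * b2) *~ (N - (m1 + m2) + s) in
  let delta1 : R := a1 - b1 in
  let delta2 : R := a2 - b2 in
  let delta3 : R := a3 - b3 in
  let sigma1 : R := a1 *~ m1 + b1 *~ (N - m1) in
  let sigma2 : R := a2 *~ m2 + b2 *~ (N - m2) in
  let sigma3 : R := a3 *~ m3 + b3 *~ (N - m3) in
  [/\ A *m B = B *m A,
      A *m B = christoffel_mx n (unit_repr u3) a3 b3,
      m1 * m2 = N * s + m3,
      delta3 = delta1 * delta2 /\ delta1 * delta2 != 0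
    & sigma3 = sigma1 * sigma2].
Proof.
move=> m1 m2 u3 m3 N A B r s a3 b3 delta1 delta2 delta3 sigma1 sigma2 sigma3.
have n0 : (0 < n)%N by apply: ltnW.
have k30 : (0 < unit_repr u1 * unit_repr u2 %% n)%N.
  by rewrite -unit_reprM //; case/andP: (unit_repr_bounds n u3 hn).
have m12 : m1 * m2 = N * s + m3.
  rewrite /s -PoszM floor_divn // /N /m3 unit_reprM // mulrC.
  exact: (congr1 Posz (divn_eq _ n)).
have rE : r = s + 1.
  by rewrite /r /s -PoszM ceil_divn // floor_divn // -addn1 PoszD.
have AB : A *m B = christoffel_mx n (unit_repr u3) a3 b3.
  rewrite /A /B mul_christoffel_mx ?unit_repr_bounds ?unit_repr_coprime //.
  by rewrite unit_reprM // /a3 /b3 /r /s -PoszM ceil_divn // floor_divn.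
have BA : B *m A = christoffel_mx n (unit_repr u3) a3 b3.
  (* Both m1 m2 and the two entries are symmetric in the factors. *)
  rewrite -AB /A /B !mul_christoffel_mx ?unit_repr_bounds ?unit_repr_coprime //.
    by rewrite [(unit_repr u2 * _)%N]mulnC !(mixed_entryC _ a1 b1 a2 b2).
  by rewrite mulnC.
split.
- by rewrite AB BA.
- exact: AB.
- exact: m12.
- split; last by rewrite mulf_neq0 ?subr_eq0.
  by rewrite /delta3 /a3 /b3 rE; apply: mixed_entry_delta.
- by rewrite /sigma3 /a3 /b3 rE; apply: mixed_entry_sigma m12.
Qed.
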